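(* Let $G=(V\cup P,E)$ be the graph of a rectangular warehouse with $m\ge1$ aisles and $n\ge2$ cross-aisles, and let $T\subseteq G$ be a minimal tour subgraph. Let $0\le j<k\le n-1$ with $k>j+1$, and suppose the part of aisle $i$ between $v_{i,j}$ and $v_{i,k}$ is a merged subaisle segment, i.e. $d_H(v_{i,\ell})=0$ for every $\ell$ with $j<\ell<k$. Then the admissible vertical configurations for a single subaisle apply to this merged segment: the vertical edges of $T$ between $v_{i,j}$ and $v_{i,k}$ form one of the six configurations (i)–(vi) listed in the context, with the whole segment from $a=v_{i,j}$ to $b=v_{i,k}$ playing the role of the single subaisle.
   Context: **Warehouse graph.** A rectangular warehouse has a single depot, $m\ge1$ vertical aisles $i=0,\dots,m-1$ (left to right) and $n\ge2$ horizontal cross-aisles $j=0,\dots,n-1$ (bottom to top). The distances between adjacent aisles and between adjacent cross-aisles are uniform. The vertex $v_{i,j}\in V$ is the intersection of aisle $i$ and cross-aisle $j$. The part of aisle $i$ between $v_{i,j}$ and $v_{i,j+1}$ is a subaisle; the horizontal distance to traverse a subaisle is negligible. $P=\{p_0,\dots,p_q\}$ is the set of locations to be visited: $p_0$ is the depot and $p_1,\dots,p_q$ are products (picks). Only $p_0$ may coincide with some $v_{i,j}$; all other elements of $P$ lie inside subaisles. The graph $G=(V\cup P,E)$ has two parallel copies of each edge. Its horizontal edges join $v_{i,j}$ and $v_{i+1,j}$; its vertical edges join consecutive vertices of $V\cup P$ along an aisle. Edge lengths are the physical distances. **Tour subgraphs.** A subgraph $T\subseteq G$ is a tour subgraph if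 it contains every vertex of $P$ and there is a closed tour using each edge of $T$ exactly once; equivalently, every vertex of $P$ is in $T$, $T$ is connected, and every vertex of $T$ has even degree. A tour subgraph is minimal if its total edge length is minimum among all tour subgraphs. **Horizontal degree.** For $T$, let $m(u,w)$ be the number of parallel edges of $T$ directly between $u,w\in V$. Define $d_H(v_{i,j})=m(v_{i-1,j},v_{i,j})+m(v_{i,j},v_{i+1,j})$, a term being $0$ if the neighbour does not exist. **Merged segments.** A merged subaisle segment is the combined part of aisle $i$ between $v_{i,j}$ and $v_{i,k}$ ($k>j+1$) such that every intermediate vertex $v_{i,\ell}$, $j<\ell<k$, has $d_H(v_{i,\ell})=0$; it is entered and exited only at its endpoints. **Admissible vertical configurations** on a subaisle (or segment) with lower endpoint $a$ and upper endpoint $b$. It is known from earlier literature that, in a minimal tour subgraph, each single subaisle ($a=v_{i,j}$, $b=v_{i,j+1}$) has one of these six configurations: (i) 1pass: one single pass along the whole of it from $a$ to $b$. (ii) Top: double edges from $b$ down to the farthest location of $P$ in it, leaving the rest untraveled. (iii) Bottom: double edges from $a$ up to the farthest location of $P$ in it, leaving the rest untraveled. (iv) Gap: double edges from $a$ upward and double edges from $b$ downward, together visiting every location of $P$ in it, chosen so as to maximize the untraveled length left between them. (v) 2pass: the whole of it from $a$ to $b$ is traversed twice (double edges throughout). (vi) None: no vertical edges; applies only when there are no locations of $P$ to visit in it.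
   Formalization: The formal theorem also assumes that some location of P is not strictly inside the merged segment; if all of P lies strictly inside, the minimal tour is a doubled path touching neither endpoint, which is none of (i)–(vi). *)

(* Defs.v *)
(* Plain MathComp. *)
From HB Require Import structures.
From mathcomp Require Import all_boot all_order all_algebra.

Set Implicit Arguments.
Unset Strict Implicit.
Unset Printing Implicit Defensive.

Import Order.TTheory GRing.Theory Num.Theory.
Local Open Scope ring_scope.

(* A point of the warehouse is a pair (aisle, height above cross-aisle 0);
   cross-aisle [j] runs at height [j * d]. *)
Definition on_cross (R : realFieldType) (m n : nat) (d : R) (p : 'I_m * R) :=
  [exists j : 'I_n, p.2 == j%:R * d].

Definition in_subaisle (R : realFieldType) (m n : nat) (d : R)
    (p : 'I_m * R) :=
  [exists j : 'I_n, (j.+1 < n)%N && (j%:R * d < p.2 < j.+1%:R * d)].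

Record warehouse (R : realFieldType) (m n : nat) := Warehouse {
  aisle_dist : R;
  cross_dist : R;
  depot : 'I_m * R;
  products : seq ('I_m * R);
  aisle_dist_gt0 : 0 < aisle_dist;
  cross_dist_gt0 : 0 < cross_dist;
  depotP : on_cross n cross_dist depot || in_subaisle n cross_dist depot;
  productsP : {in products, forall p, in_subaisle n cross_dist p}
}.

Section Graph.
Variables (R : realFieldType) (m n : nat) (W : warehouse R m n).

Definition crossing (i : 'I_m) (j : 'I_n) : 'I_m * R :=
  (i, j%:R * cross_dist W).

Definition locations : seq ('I_m * R) := depot W :: products W.

Definition crossings : seq ('I_m * R) :=
  [seq crossing i j | i <- enum 'I_m, j <- enum 'I_n].

(* The vertices of G are the points of V and P, so that a depot located on a
   crossing is the same vertex as that crossing. *)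
Definition vertex : finType := seq_sub (crossings ++ locations).

Definition aisle (u : vertex) : 'I_m := (ssval u).1.
Definition height (u : vertex) : R := (ssval u).2.
Definition is_location (u : vertex) : bool := ssval u \in locations.

Lemma crossing_vertex i j : crossing i j \in crossings ++ locations.
Proof.
by rewrite mem_cat; apply/orP; left; apply/allpairsP; exists (i, j);
   rewrite !mem_enum.
Qed.

Definition v (i : 'I_m) (j : 'I_n) : vertex := SeqSub (crossing_vertex i j).

(* Edges are listed once per unordered pair, oriented rightwards or upwards. *)
Definition hedge (u w : vertex) : bool :=
  [exists i : 'I_m, exists i' : 'I_m, exists j : 'I_n,
    [&& i' == i.+1 :> nat, u == v i j & w == v i' j]].

Definition vedge (u w : vertex) : bool :=
  [&& aisle u == aisle w, height u < height w &
    [forall z : vertex,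
      (aisle z == aisle u) ==> ~~ (height u < height z < height w)]].

Definition edge_length (u w : vertex) : R :=
  if aisle u == aisle w then height w - height u else aisle_dist W.

(* The boolean selects one of the two parallel copies. *)
Record subgraph := Subgraph {
  sub_vertices : {set vertex};
  sub_edges : {set vertex * vertex * bool};
  sub_edgesP : forall u w c, (u, w, c) \in sub_edges ->
    [&& hedge u w || vedge u w, u \in sub_vertices & w \in sub_vertices]
}.

Section Tour.
Variable T : subgraph.

Definition mult (u w : vertex) : nat :=
  (#|[set c : bool | (u, w, c) \in sub_edges T]|
   + #|[set c : bool | (w, u, c) \in sub_edges T]|)%N.

Definition degree (u : vertex) : nat := (\sum_(w : vertex) mult u w)%N.

Definition connected : Prop :=
  {in sub_vertices T &, forall u w,
    connect (fun x y => (0 < mult x y)%N) u w}.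

Definition tour_subgraph : Prop :=
  [/\ forall p, is_location p -> p \in sub_vertices T,
      connected
    & {in sub_vertices T, forall u, ~~ odd (degree u)}].

Definition total_length : R :=
  \sum_(e in sub_edges T) edge_length e.1.1 e.1.2.

End Tour.

Definition minimal_tour_subgraph (T : subgraph) : Prop :=
  tour_subgraph T /\
  forall T', tour_subgraph T' -> total_length T <= total_length T'.

Section Segment.
Variables (T : subgraph) (i : 'I_m) (j k : 'I_n).

Definition dH (l : 'I_n) : nat :=
  (\sum_(i' : 'I_m | i'.+1 == i :> nat) mult T (v i' l) (v i l)
   + \sum_(i' : 'I_m | i' == i.+1 :> nat) mult T (v i l) (v i' l))%N.

Definition merged_segment : Prop :=
  (j.+1 < k)%N /\ forall l : 'I_n, (j < l < k)%N -> dH l = 0%N.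

(* The locations to visit in the segment are those strictly between its
   endpoints: a depot sitting on an endpoint does not count. *)
Definition location_inside (p : vertex) : bool :=
  [&& is_location p, aisle p == i & height (v i j) < height p < height (v i k)].

Definition segment_vertex (u : vertex) : bool :=
  (aisle u == i) && (height (v i j) <= height u <= height (v i k)).

Definition segment_edge (u w : vertex) : bool :=
  [&& vedge u w, segment_vertex u & segment_vertex w].

Definition all_mult (c : nat) : Prop :=
  forall u w, segment_edge u w -> mult T u w = c.

(* Nothing between [x] and [y], double edges on the rest of the segment. *)
Definition untraveled_exactly (x y : vertex) : Prop :=
  forall u w, segment_edge u w ->
    mult T u w =
      if (height x <= height u) && (height w <= height y) then 0%N else 2%N.

(* Stretches that may be left untraveled while every location is visited by
   double edges from the endpoints; either run of double edges may be empty. *)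
Definition free_stretch (x y : vertex) : Prop :=
  [/\ segment_vertex x, segment_vertex y, height x < height y
    & forall p, location_inside p -> ~~ (height x < height p < height y)].

Inductive vconfig := OnePass | Top | Bottom | Gap | TwoPass | NoEdges.

Definition has_config (c : vconfig) : Prop :=
  match c with
  | OnePass => all_mult 1
  | Top => exists p,
      [/\ location_inside p,
          forall p', location_inside p' -> height p <= height p'
        & untraveled_exactly (v i j) p]
  | Bottom => exists p,
      [/\ location_inside p,
          forall p', location_inside p' -> height p' <= height p
        & untraveled_exactly p (v i k)]
  | Gap => exists x y,
      [/\ free_stretch x y,
          height (v i j) < height x, height y < height (v i k),
          forall x' y', free_stretch x' y' ->
            height y' - height x' <= height y - height x
        & untraveled_exactly x y]
  | TwoPass => all_mult 2
  | NoEdges => (forall p, ~~ location_inside p) /\ all_mult 0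
  end.

End Segment.
End Graph.

(* Main.v *)
Require Import Defs.
From mathcomp Require Import all_boot all_order all_algebra.
From mathcomp Require Import lra.

(** Let [a] and [b] be the endpoints of the merged segment.

    Parity.  No horizontal edge leaves an interior vertex of the segment, so its
    degree is the sum of the multiplicities of the two vertical edges around it
    ([degree_interior]).  Degrees in a tour are even, hence all edges of the
    segment have multiplicities of the same parity ([segment_parity]).  As no
    multiplicity exceeds 2, an odd parity gives a single pass.

    Shape.  Suppose the parity is even.  If no edge is unused, the segment is
    traversed twice.  Otherwise let [x] be the lower end of the lowest unused
    edge and [y] the upper end of the highest one.  The vertices strictly between
    [x] and [y] are cut off from the rest of the graph; since the tour is
    connected and has a location outside the segment, it meets none of them.
    So the tour is double on the segment except between [x] and [y], where
    nothing is travelled and no location lies ([untraveled_stretch]).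

    Optimality.  The segment can be rerouted: any stretch free of locations may
    be the untravelled one, with double edges elsewhere.  The result is again a
    tour ([reroute_tour]).  In both tours the segment is cut, so parts of the
    tour outside the segment were never joined through it and stay joined
    without it: collapsing the interior of the segment onto its endpoints maps
    old walks to new ones ([retract_conn]).  The two tours differ in length by
    twice the difference of the untravelled lengths, so in a minimal tour the
    stretch from [x] to [y] is a longest one among those that may replace it
    ([untraveled_maximal]).  The replacement must not end its double edges at an
    endpoint that the tour does not visit; this is the condition [anchored].

    The four cases [x = a] or not, [y = b] or not, are then the configurations
    without edges, Top, Bottom and Gap; in Top and Bottom, maximality forces the
    inner end of the stretch to be the farthest location. *)

Set Implicit Arguments.
Unset Strict Implicit.
Unset Printing Implicit Defensive.

Import Order.TTheory GRing.Theory Num.Theory.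

(* Equations between aisles or vertices and disjunctions mentioning them are
   not arithmetical; they are discarded before comparing heights. *)
Ltac height_lra :=
  repeat match goal with
  | H : _ = _ |- _ => clear H
  | H : _ \/ _ |- _ => clear H
  end; lra.

(** * Vertices and vertical edges of an aisle *)

Section Aisles.
Local Open Scope ring_scope.
Variables (R : realFieldType) (m n : nat) (W : warehouse R m n).
Implicit Types (u w z p q : vertex W).

Lemma vertex_eq u w : aisle u = aisle w -> height u = height w -> u = w.
Proof.
move=> ha hh; apply: val_inj => /=.
by move: ha hh; rewrite /aisle /height; case: (ssval u) (ssval w) => [? ?] [? ?] /= -> ->.
Qed.

Lemma vedge_aisle u w : vedge u w -> aisle u = aisle w.
Proof. by case/and3P=> /eqP. Qed.

Lemma vedge_lt u w : vedge u w -> height u < height w.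
Proof. by case/and3P. Qed.

Lemma vedge_outside u w z : vedge u w -> aisle z = aisle u ->
  (height z <= height u) || (height w <= height z).
Proof.
case/and3P=> _ _ /forallP/(_ z) + az; rewrite az eqxx /= negb_and -!leNgt.
by [].
Qed.

Lemma vedge_sourceI u u' w : vedge u w -> vedge u' w -> u = u'.
Proof.
move=> e e'; have ha : aisle u = aisle u' by rewrite (vedge_aisle e) (vedge_aisle e').
apply: vertex_eq => //; have := vedge_outside e (esym ha).
have := vedge_outside e' ha; have := vedge_lt e; have := vedge_lt e'.
by move=> ? ? /orP[] ? /orP[] ?; lra.
Qed.

Lemma vedge_targetI u w w' : vedge u w -> vedge u w' -> w = w'.
Proof.
move=> e e'; have ha : aisle w = aisle w' by rewrite -(vedge_aisle e) (vedge_aisle e').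
apply: vertex_eq => //; have := vedge_outside e (esym (vedge_aisle e')).
have := vedge_outside e' (esym (vedge_aisle e)); have := vedge_lt e; have := vedge_lt e'.
by move=> ? ? /orP[] ? /orP[] ?; lra.
Qed.

Lemma vedge_below p q : aisle p = aisle q -> height p < height q ->
  exists2 u, vedge u q & height p <= height u.
Proof.
move=> ha hpq; pose P z := (aisle z == aisle q) && (height z < height q).
have Pp : P p by rewrite /P ha eqxx.
have [u /andP[/eqP au uq] umax] := Order.TotalTheory.arg_maxP (@height R m n W) Pp.
exists u; last exact: umax.
rewrite /vedge au eqxx uq /=; apply/forallP=> z; apply/implyP=> az.
apply/negP=> /andP[uz zq]; have := umax z; rewrite /P az zq => /(_ isT).
by move/(lt_le_trans uz); rewrite ltxx.
Qed.

Lemma vedge_above p q : aisle p = aisle q -> height p < height q ->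
  exists2 w, vedge p w & height w <= height q.
Proof.
move=> ha hpq; pose P z := (aisle z == aisle p) && (height p < height z).
have Pp : P q by rewrite /P ha eqxx.
have [u /andP[/eqP au uq] umin] := Order.TotalTheory.arg_minP (@height R m n W) Pp.
exists u; last exact: umin.
rewrite /vedge au eqxx uq /=; apply/forallP=> z; apply/implyP=> az.
apply/negP=> /andP[uz zq]; have := umin z; rewrite /P az uz => /(_ isT).
by move/(lt_le_trans zq); rewrite ltxx.
Qed.

(** The vertices of an aisle are not given as a sorted sequence; this induction
    along its vertical edges stands for the induction on such a sequence. *)
Lemma aisle_ind p (P : vertex W -> Prop) : P p ->
    (forall u w, vedge u w -> aisle u = aisle p -> height p <= height u ->
       P u -> P w) ->
  forall q, aisle q = aisle p -> height p <= height q -> P q.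
Proof.
move=> Pp step q.
pose below (z : vertex W) :=
  [set t : vertex W | (aisle t == aisle p) && (height t < height z)].
have [N] := ubnP #|below q|; elim: N q => // N IH q leN aq.
rewrite le_eqVlt => /orP[/eqP hpq|hpq]; first by rewrite -(vertex_eq (esym aq) hpq).
have [u e hpu] := vedge_below (esym aq) hpq; have au := etrans (vedge_aisle e) aq.
apply: (step u) => //; apply: IH => //; apply: (@leq_trans #|below q|) => [|//].
apply/proper_card/properP; split.
  by apply/subsetP=> z; rewrite !inE => /andP[-> /lt_trans->] //; apply: vedge_lt.
by exists u; rewrite !inE ?au ?eqxx ?ltxx //= (vedge_lt e).
Qed.

(** Telescoping: the last edge below [q] carries the induction step. *)
Lemma sum_vedge_length p q : aisle q = aisle p -> height p <= height q ->
  \sum_(e : vertex W * vertex W | [&& vedge e.1 e.2, aisle e.1 == aisle p,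
      height p <= height e.1 & height e.2 <= height q])
    (height e.2 - height e.1) = height q - height p.
Proof.
move: q; apply: aisle_ind.
  rewrite subrr big_pred0 // => -[u w] /=; apply/and4P=> -[/vedge_lt ? _ ? ?]; lra.
move=> u w e au hpu IH; have uw := vedge_lt e.
rewrite (bigD1 (u, w)) /=; last by rewrite e au eqxx hpu lexx.
rewrite (eq_bigl (fun e => [&& vedge e.1 e.2, aisle e.1 == aisle p,
      height p <= height e.1 & height e.2 <= height u])) ?IH => [|[u' w'] /=].
  lra.
apply/andP/and4P=> [[/and4P[e' /eqP au' hpu' hw'] neq]|[e' /eqP au' hpu' hw']].
  split=> //; first exact/eqP.
  have aw' : aisle w' = aisle u by rewrite -(vedge_aisle e') au' au.
  case/orP: (vedge_outside e aw') => // hw.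
  have ww' : w' = w by apply: vertex_eq; [rewrite aw' (vedge_aisle e) | lra].
  by case/eqP: neq; rewrite ww' in e' *; rewrite (vedge_sourceI e e').
split; first by rewrite e' au' eqxx hpu'; lra.
by apply/eqP=> -[_ ew]; move: hw'; rewrite ew leNgt uw.
Qed.

Lemma hedge_aisle u w : hedge u w -> aisle u != aisle w.
Proof.
case/existsP=> i /existsP[i' /existsP[j /and3P[/eqP ii' /eqP-> /eqP->]]].
rewrite /aisle /=; apply/eqP=> ei; move: ii'; rewrite -ei => /eqP.
by rewrite (ltn_eqF (ltnSn _)).
Qed.

End Aisles.

(** * Multiplicities of edges in a subgraph *)

Section Subgraphs.
Local Open Scope ring_scope.
Variables (R : realFieldType) (m n : nat) (W : warehouse R m n).
Implicit Types (u w z p q : vertex W) (T : subgraph W).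

Lemma multC T u w : mult T u w = mult T w u.
Proof. by rewrite /mult addnC. Qed.

Lemma card_edge_gt0 T u w :
  (0 < #|[set c : bool | (u, w, c) \in sub_edges T]|)%N ->
  exists c, (u, w, c) \in sub_edges T.
Proof. by rewrite card_gt0 => /set0Pn[c]; rewrite inE; exists c. Qed.

Lemma mult_gt0P T u w : (0 < mult T u w)%N ->
  exists c, ((u, w, c) \in sub_edges T) \/ ((w, u, c) \in sub_edges T).
Proof.
rewrite /mult addn_gt0 => /orP[] /card_edge_gt0[c hc]; exists c; by [left|right].
Qed.

Lemma edge_mult T u w c : (u, w, c) \in sub_edges T -> (0 < mult T u w)%N.
Proof.
move=> h; rewrite /mult addn_gt0 card_gt0; apply/orP; left.
by apply/set0Pn; exists c; rewrite inE.
Qed.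

Lemma mult_mem T u w : (0 < mult T u w)%N ->
  u \in sub_vertices T /\ w \in sub_vertices T.
Proof. by case/mult_gt0P=> c [] /sub_edgesP /and3P[]. Qed.

(** Edges are stored in one orientation only, so one of the two terms of [mult]
    vanishes. *)
Lemma vedge_mult T u w : vedge u w ->
  mult T u w = #|[set c : bool | (u, w, c) \in sub_edges T]|.
Proof.
move=> e; rewrite /mult [X in (_ + X)%N](_ : _ = 0)%N ?addn0 //.
apply/eqP; rewrite cards_eq0; apply/eqP/setP=> c; rewrite !inE.
apply/negP=> /sub_edgesP/andP[/orP[/hedge_aisle|/vedge_lt]].
  by rewrite (vedge_aisle e) eqxx.
by have := vedge_lt e => ? ?; lra.
Qed.

Lemma vedge_mult_le2 T u w : vedge u w -> (mult T u w <= 2)%N.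
Proof. by move=> /vedge_mult->; rewrite -card_bool; apply: max_card. Qed.

Lemma mult0_edge T u w c : mult T u w = 0%N -> (u, w, c) \notin sub_edges T.
Proof. by move=> h; apply/negP=> /edge_mult; rewrite h. Qed.

Lemma mult2_edge T u w c : vedge u w -> mult T u w = 2%N ->
  (u, w, c) \in sub_edges T.
Proof.
move=> /vedge_mult-> h.
suff /setP/(_ c) : [set c : bool | (u, w, c) \in sub_edges T] = setT by rewrite !inE.
by apply/eqP; rewrite eqEcard subsetT h cardsT card_bool.
Qed.

(** Vertices outside the tour have degree 0, so evenness holds for all of them. *)
Lemma even_degree T u : tour_subgraph T -> ~~ odd (degree T u).
Proof.
case=> _ _ ev; have [/ev//|uT] := boolP (u \in sub_vertices T).
rewrite /degree big1 // => w _; apply/eqP; rewrite -leqn0 leqNgt.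
by apply/negP=> /mult_mem[]; rewrite (negPf uT).
Qed.

End Subgraphs.

(** * The interior of a merged segment *)

Section Segment.
Local Open Scope ring_scope.
Variables (R : realFieldType) (m n : nat) (W : warehouse R m n).
Variables (i : 'I_m) (j k : 'I_n).
Implicit Types (u w z p q x y : vertex W) (T : subgraph W).

Local Notation a := (v W i j).
Local Notation b := (v W i k).
Local Notation segv := (@segment_vertex R m n W i j k).
Local Notation sege := (@segment_edge R m n W i j k).

Definition interior u := (aisle u == i) && (height a < height u < height b).

Lemma height_v i' (l l' : 'I_n) :
  (height (v W i l) < height (v W i' l')) = (l < l')%N.
Proof. by rewrite /height /= ltr_pM2r ?cross_dist_gt0 // ltr_nat. Qed.

Lemma segvP u : reflect
  [/\ aisle u = i, height a <= height u & height u <= height b] (segv u).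
Proof. by apply: (iffP and3P) => -[/eqP ? ? ?]; split. Qed.

Lemma segeP u w : reflect
  [/\ vedge u w, aisle u = i, height a <= height u & height w <= height b]
  (sege u w).
Proof.
apply: (iffP and3P) => [[e /segvP[au hu _] /segvP[_ _ hw]]|[e au hu hw]].
  by split.
have uw := vedge_lt e.
by split=> //; apply/segvP; split; rewrite -?(vedge_aisle e) //; height_lra.
Qed.

Lemma segv_interior u : segv u -> ~~ interior u -> u = a \/ u = b.
Proof.
case/segvP=> au hau hub; rewrite /interior au eqxx /=.
have [ea _|na] := eqVneq (height u) (height a).
  by left; apply: vertex_eq.
have [eb _|nb] := eqVneq (height u) (height b).
  by right; apply: vertex_eq.
by rewrite !lt_neqAle eq_sym na nb hau hub.
Qed.

Lemma location_interior p : location_inside i j k p = is_location p && interior p.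
Proof. by []. Qed.

Lemma interior_horizontal T u w c : merged_segment T i j k ->
    ((u, w, c) \in sub_edges T) || ((w, u, c) \in sub_edges T) ->
  interior u -> ~~ (hedge u w || hedge w u).
Proof.
move=> [_ hd] euw /and3P[/eqP au hau hub].
have uw : (0 < mult T u w)%N by case/orP: euw => /edge_mult; rewrite // multC.
have dH0 (l : 'I_n) : u = v W i l -> dH T i l = 0%N.
  by move=> eu; apply: hd; move: hau hub; rewrite eu !height_v => -> ->.
apply/negP=> /orP[] /existsP[i1 /existsP[i2 /existsP[l /and3P[/eqP e12 /eqP e1 /eqP e2]]]].
  have i1E : i1 = i by rewrite -au e1.
  rewrite i1E in e1 e12; move: (dH0 _ e1) uw; rewrite /dH => /eqP.
  rewrite addn_eq0 => /andP[_]; rewrite (bigD1 i2) ?e12 ?eqxx //= addn_eq0.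
  by rewrite e1 e2 => /andP[/eqP->].
have i2E : i2 = i by rewrite -au e2.
rewrite i2E in e2 e12; move: (dH0 _ e2) uw; rewrite /dH => /eqP.
rewrite addn_eq0 => /andP[+ _]; rewrite (bigD1 i1) ?e12 ?eqxx //= addn_eq0.
by rewrite multC e1 e2 => /andP[/eqP->].
Qed.

(** An edge at an interior vertex is vertical, and it cannot reach beyond the
    endpoints because these are themselves vertices of the aisle. *)
Lemma segment_edge_of_interior T u w c : merged_segment T i j k ->
  (u, w, c) \in sub_edges T -> interior u || interior w -> sege u w.
Proof.
move=> hm e inuw.
have nh : ~~ hedge u w.
  case/orP: inuw => h; [have := interior_horizontal (w := w) (c := c) hm _ h
                      | have := interior_horizontal (w := u) (c := c) hm _ h];
  by rewrite e ?orbT => /(_ isT); rewrite negb_or => /andP[].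
have := sub_edgesP e; rewrite (negPf nh) /= => /andP[ve _].
have lt := vedge_lt ve; have uw := vedge_aisle ve.
case/orP: inuw => /and3P[/eqP ai h1 h2]; rewrite ?uw in ai;
  apply/segeP; split; rewrite ?uw //; try height_lra.
- have bu : aisle b = aisle u by rewrite uw ai.
  by have := vedge_outside ve bu => /orP[]; height_lra.
- have au : aisle a = aisle u by rewrite uw ai.
  by have := vedge_outside ve au => /orP[]; height_lra.
Qed.

Lemma interior_neighbour T u w : merged_segment T i j k -> interior w ->
  (0 < mult T w u)%N -> sege u w \/ sege w u.
Proof.
move=> hm iw /mult_gt0P[c []] /(segment_edge_of_interior hm);
by rewrite iw ?orbT => /(_ isT); auto.
Qed.

Lemma degree_interior T u w z : merged_segment T i j k -> interior w ->
  vedge u w -> vedge w z -> degree T w = (mult T u w + mult T w z)%N.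
Proof.
move=> hm iw euw ewz.
have uw := vedge_lt euw; have wz := vedge_lt ewz.
rewrite /degree (bigD1 u) // (bigD1 z) /=; last first.
  by apply/eqP=> zu; move: wz; rewrite zu; height_lra.
rewrite big1 ?addn0 1?(multC T w u) // => t /andP[tu tz].
apply/eqP; rewrite -leqn0 leqNgt; apply/negP=> /(interior_neighbour hm iw).
case=> /segeP[e _ _ _]; first by rewrite (vedge_sourceI e euw) eqxx in tu.
by rewrite (vedge_targetI e ewz) eqxx in tz.
Qed.

(** Both multiplicities at an interior vertex have the parity of an even degree
    as their sum, so the parity of the lowest edge propagates upwards. *)
Lemma segment_parity T u w u' w' : merged_segment T i j k -> tour_subgraph T ->
  sege u w -> sege u' w' -> odd (mult T u w) = odd (mult T u' w').
Proof.
move=> hm hT.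
(* It suffices to compare every edge with the lowest one, from [a] to [w1]. *)
suff base t0 : forall w1, sege a w1 -> odd (mult T a w1) = t0 ->
    forall u w, sege u w -> odd (mult T u w) = t0.
  move=> euw eu'w'; have [e _ hau hwb] := segeP _ _ euw.
  have hab : height a < height b by have := vedge_lt e; height_lra.
  have [w1 ve1 hw1] := vedge_above (erefl : aisle a = aisle b) hab.
  have e1 : sege a w1 by apply/segeP; split=> //.
  by rewrite (base _ _ e1 erefl _ _ euw) (base _ _ e1 erefl _ _ eu'w').
move=> w1 /segeP[e1 _ _ _] t0E {}u {}w /segeP[e au hau].
move: au hau w e.
pose P z := forall w, vedge z w -> height w <= height b -> odd (mult T z w) = t0.
move=> au hau; apply: (@aisle_ind _ _ _ _ a P _ _ u au hau).
  by move=> w e _; rewrite (vedge_targetI e e1).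
move=> {au hau} {}u z euz au hau IH w ezw hwb.
have uz := vedge_lt euz; have zw := vedge_lt ezw.
have iz : interior z.
  by rewrite /interior -(vedge_aisle euz) au eqxx /=; apply/andP; split; height_lra.
have := even_degree z hT; rewrite (degree_interior hm iz euz ezw) oddD.
rewrite IH //; last by height_lra.
by rewrite negb_add => /eqP.
Qed.

(** * Rerouting the segment *)

Section Reroute.
Variable T : subgraph W.

Definition stretch_edge x y u w :=
  (height x <= height u) && (height w <= height y).

Definition rerouted_edges x y : {set vertex W * vertex W * bool} :=
  [set e | if sege e.1.1 e.1.2 then ~~ stretch_edge x y e.1.1 e.1.2
           else e \in sub_edges T].

Definition rerouted_vertices x y : {set vertex W} :=
  [set u | if interior u then (height u <= height x) || (height y <= height u)
           else u \in sub_vertices T].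

(** Double edges leaving an endpoint of the segment stay connected to the rest of
    the tour only if the tour visits that endpoint. *)
Definition anchored x y :=
  [/\ segv x, segv y, height x < height y,
      x = a \/ a \in sub_vertices T & y = b \/ b \in sub_vertices T].

Lemma vedge_stretch x y u w : segv x -> segv y -> sege u w ->
  ~~ stretch_edge x y u w -> (height w <= height x) || (height y <= height u).
Proof.
case/segvP=> ax _ _ /segvP[ay _ _] /segeP[e au _ _].
have := vedge_outside e (etrans ax (esym au)).
have := vedge_outside e (etrans ay (esym au)).
have := vedge_lt e; rewrite /stretch_edge negb_and -!ltNge => ?.
by move=> /orP[] ? /orP[] ? /orP[] ?; apply/orP; first [left; height_lra | right; height_lra].
Qed.

Lemma rerouted_edgesP x y : merged_segment T i j k -> anchored x y ->
  forall u w c, (u, w, c) \in rerouted_edges x y ->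
  [&& hedge u w || vedge u w, u \in rerouted_vertices x y
    & w \in rerouted_vertices x y].
Proof.
move=> hm [sx sy xy xa yb] u w c; rewrite !inE /=.
case: ifP => [euw|euw e]; last first.
  have := sub_edgesP e; case: ifP => iu.
    by rewrite (segment_edge_of_interior hm e) ?iu in euw.
  case: ifP => iw //.
  by rewrite (segment_edge_of_interior hm e) ?iw ?orbT in euw.
move=> /(vedge_stretch sx sy euw) uwxy.
have [e au hau hwb] := segeP _ _ euw; have uw := vedge_lt e.
have [_ su sw] := and3P euw.
have [_ hax _] := segvP _ sx; have [_ _ hyb] := segvP _ sy.
rewrite e orbT /=; apply/andP; split; case: ifPn => [_|ni].
- by case/orP: uwxy => ?; apply/orP; [left|right]; height_lra.
- case: (segv_interior su ni) => eu; rewrite eu in uw uwxy *; last (exfalso; height_lra).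
  case: xa => // xa; rewrite xa in uwxy xy; case/orP: uwxy => ?; exfalso; height_lra.
- by case/orP: uwxy => ?; apply/orP; [left|right]; height_lra.
case: (segv_interior sw ni) => ew; rewrite ew in uw uwxy *; first (exfalso; height_lra).
case: yb => // yb; rewrite yb in uwxy xy; case/orP: uwxy => ?; exfalso; height_lra.
Qed.

Definition reroute x y (hm : merged_segment T i j k) (h : anchored x y) :=
  Subgraph (rerouted_edgesP hm h).

(** The right-hand side does not depend on [x] and [y], so two reroutings differ
    in length by twice the difference of their untravelled stretches. *)
Lemma sum_rerouted_length x y : segv x -> segv y -> height x <= height y ->
  \sum_(e in rerouted_edges x y) edge_length e.1.1 e.1.2
    + (height y - height x) *+ 2 =
  \sum_(e | sege e.1.1 e.1.2 || (e \in sub_edges T)) edge_length e.1.1 e.1.2.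
Proof.
move=> /segvP[ax hax hxb] /segvP[ay hay hyb] xy.
rewrite [RHS](bigID (fun e => sege e.1.1 e.1.2 && stretch_edge x y e.1.1 e.1.2)) /=.
rewrite addrC; congr (_ + _).
  apply: eq_bigl => e; rewrite inE.
  by case: ifP => [se|_] /=; rewrite ?se ?andbT.
rewrite -(sum_vedge_length (etrans ay (esym ax)) xy) -sumrMnl.
pose P (e : vertex W * vertex W) := [&& vedge e.1 e.2, aisle e.1 == aisle x,
   height x <= height e.1 & height e.2 <= height y].
transitivity (\sum_(e : vertex W * vertex W | P e) \sum_(c : bool) (height e.2 - height e.1)).
  by apply: eq_bigr => e _; rewrite sumr_const card_bool.
rewrite pair_big /=; apply: eq_big => [[[u w] c]|[[u w] c]] /=; last first.
  by rewrite andbT => /and4P[/vedge_aisle e _ _ _]; rewrite /edge_length e eqxx.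
rewrite andbT /P /= /stretch_edge.
apply/and4P/and3P => [[e /eqP au h1 h2]|[_ se /andP[h1 h2]]].
  have se : sege u w by apply/segeP; split=> //; rewrite ?au //; height_lra.
  by split; rewrite ?se ?h1.
by have [e au _ _] := segeP _ _ se; split=> //; rewrite au ax.
Qed.

End Reroute.
End Segment.

(** * A rerouted tour is a tour *)

Section RerouteTour.
Local Open Scope ring_scope.
Variables (R : realFieldType) (m n : nat) (W : warehouse R m n).
Variables (T : subgraph W) (i : 'I_m) (j k : 'I_n).
Hypothesis hm : merged_segment T i j k.
Implicit Types (u w z p q x y : vertex W).

Local Notation a := (v W i j).
Local Notation b := (v W i k).
Local Notation sege := (segment_edge i j k).
Local Notation conn S := (connect (fun u w => 0 < mult S u w)%N).

Lemma conn_sym (S : subgraph W) u w : conn S u w = conn S w u.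
Proof. by apply: sym_connect_sym => ? ?; rewrite multC. Qed.

(** A tour of the even shape is its own rerouting, so its length is given by
    [sum_rerouted_length] too. *)
Lemma untraveled_edges x y : untraveled_exactly T i j k x y ->
  sub_edges T = rerouted_edges i j k T x y.
Proof.
move=> h; apply/setP=> -[[u w] c]; rewrite inE /=; case: ifP => // se.
have := h _ _ se; rewrite /stretch_edge; case: ifP => _ /= hmu.
  by rewrite (negPf (mult0_edge _ hmu)).
by rewrite mult2_edge //; case/and3P: se.
Qed.

Variables (x y : vertex W) (hxy : anchored i j k T x y).
Local Notation T' := (reroute hm hxy).

Lemma mult_reroute_segment u w : sege u w ->
  mult T' u w = if stretch_edge x y u w then 0%N else 2%N.
Proof.
move=> se; rewrite vedge_mult; last by case/and3P: se.
have -> : [set c : bool | (u, w, c) \in sub_edges T']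
    = [set c : bool | ~~ stretch_edge x y u w].
  by apply/setP=> c; rewrite !inE /= se.
case: (stretch_edge _ _ _ _); last by rewrite cardsT card_bool.
by apply/eqP; rewrite cards_eq0.
Qed.

Lemma mult_reroute_other u w : ~~ sege u w -> ~~ sege w u ->
  mult T' u w = mult T u w.
Proof.
by move=> /negPf nuw /negPf nwu; rewrite /mult; congr (_ + _)%N;
   apply: eq_card => c; rewrite !inE /= ?nuw ?nwu.
Qed.

(** Rerouting exchanges even multiplicities for even multiplicities. *)
Lemma degree_reroute_odd : (forall u w, sege u w -> ~~ odd (mult T u w)) ->
  forall u, odd (degree T' u) = odd (degree T u).
Proof.
move=> ev u.
have oddS (S : subgraph W) : odd (degree S u) = \big[addb/false]_w odd (mult S u w).
  by rewrite /degree (big_morph odd oddD (erefl : odd 0 = false)).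
rewrite !oddS; apply: eq_bigr => w _.
have evseg u1 w1 : sege u1 w1 -> odd (mult T' u1 w1) = odd (mult T u1 w1).
  by move=> se; rewrite (negPf (ev _ _ se)) mult_reroute_segment //; case: ifP.
have [/evseg//|nuw] := boolP (sege u w).
have [/evseg|nwu] := boolP (sege w u); first by rewrite !(multC _ w).
by rewrite mult_reroute_other.
Qed.

Lemma reroute_conn_lower u : aisle u = i -> height a <= height u ->
  height u <= height x -> conn T' a u.
Proof.
have [/segvP[ax hax hxb] _ xy _ _] := hxy.
pose P z := height z <= height x -> conn T' a z.
move=> au hau; apply: (@aisle_ind _ _ _ _ a P _ _ u au hau).
  by move=> _; apply: connect0.
move=> {au hau} {}u w e au hau IH hwx; have uw := vedge_lt e.
apply: connect_trans (IH _) (connect1 _); first height_lra.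
have se : sege u w by apply/segeP; split=> //; height_lra.
rewrite mult_reroute_segment // /stretch_edge.
by rewrite [height x <= _]leNgt (_ : height u < height x) //; height_lra.
Qed.

Lemma reroute_conn_upper u : aisle u = i -> height y <= height u ->
  height u <= height b -> conn T' b u.
Proof.
have [_ /segvP[ay hay hyb] xy _ _] := hxy.
have up z : aisle z = aisle y -> height y <= height z -> height z <= height b ->
    conn T' y z.
  pose P z := height z <= height b -> conn T' y z.
  move=> az hyz; apply: (@aisle_ind _ _ _ _ y P _ _ z az hyz).
    by move=> _; apply: connect0.
  move=> {az hyz} {}u w e au hyu IH hwb; have uw := vedge_lt e.
  apply: connect_trans (IH _) (connect1 _); first height_lra.
  have se : sege u w by apply/segeP; split=> //; [rewrite au | height_lra].
  rewrite mult_reroute_segment // /stretch_edge [height w <= _]leNgt.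
  by rewrite (_ : height y < height w) ?andbF //; height_lra.
move=> au hyu hub; apply: (@connect_trans _ _ y).
  by rewrite conn_sym; apply: up.
by apply: up; rewrite ?ay.
Qed.

(** In the rerouted graph an interior vertex is joined to an endpoint by double
    edges, and the stretch being anchored, that endpoint is in the tour. *)
Lemma reroute_anchor u : u \in sub_vertices T' ->
  exists u', [/\ u' \in sub_vertices T, ~~ interior i j k u' & conn T' u u'].
Proof.
have [/segvP[ax hax hxb] /segvP[ay hay hyb] xy xa yb] := hxy.
rewrite inE; case: ifPn => [iu|niu uT]; last by exists u; rewrite uT niu.
have [/eqP au h1 h2] := and3P iu.
case/orP=> hu; [exists a | exists b].
  split; last by rewrite conn_sym; apply: reroute_conn_lower => //; height_lra.
    by case: xa => // xa; move: hu; rewrite xa; height_lra.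
  by rewrite /interior ltxx andbF.
split; last by rewrite conn_sym; apply: reroute_conn_upper => //; height_lra.
  by case: yb => // yb; move: hu; rewrite yb; height_lra.
by rewrite /interior ltxx !andbF.
Qed.

Variables (x0 y0 : vertex W).
Hypothesis (sx0 : segment_vertex i j k x0) (sy0 : segment_vertex i j k y0).
Hypothesis x0y0 : height x0 < height y0.
Hypothesis untr : untraveled_exactly T i j k x0 y0.

(** A walk of the tour entering the segment at an endpoint must leave it there;
    collapsing both travelled parts onto their endpoints removes such excursions
    and leaves a walk that survives the rerouting. *)
Definition retract u : vertex W :=
  if interior i j k u then (if height u <= height x0 then a else b) else u.

(** An edge of the tour inside the segment is contracted to a point, since it
    lies on one side of the untravelled stretch; an edge outside the segment
    survives the rerouting. *)
Lemma retract_adj u w : (0 < mult T u w)%N -> conn T' (retract u) (retract w).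
Proof.
have [/segvP[ax0 hax0 hx0b] /segvP[ay0 hay0 hy0b]] := (sx0, sy0).
have xy0 := x0y0.
have seg u1 w1 : sege u1 w1 -> (0 < mult T u1 w1)%N -> retract u1 = retract w1.
  move=> se; rewrite untr //; case: ifPn => // uwxy _.
  have [e au hau hwb] := segeP _ _ _ _ _ se; have uw := vedge_lt e.
  have [_ su sw] := and3P se.
  rewrite /retract; case/orP: (vedge_stretch sx0 sy0 se uwxy) => hx.
    have iw : interior i j k w1.
      by apply/and3P; split; rewrite -?(vedge_aisle e) ?au //; height_lra.
    rewrite iw hx; case: ifPn => [_|/(segv_interior su)[]//].
      by rewrite (_ : height u1 <= height x0) //; height_lra.
    by move=> eu; exfalso; move: uw; rewrite eu; height_lra.
  have iu : interior i j k u1 by apply/and3P; split; rewrite ?au //; height_lra.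
  rewrite iu leNgt (_ : height x0 < height u1) /=; last height_lra.
  case: ifPn => [_|/(segv_interior sw)[]//].
    by rewrite leNgt (_ : height x0 < height w1) //=; height_lra.
  by move=> ew; exfalso; move: uw; rewrite ew; height_lra.
move=> uw; have [/seg/(_ uw)->|nuw] := boolP (sege u w); first exact: connect0.
have wu : (0 < mult T w u)%N by rewrite multC.
have [/seg/(_ wu)->|nwu] := boolP (sege w u); first exact: connect0.
have ni u1 w1 : (0 < mult T u1 w1)%N -> ~~ sege u1 w1 -> ~~ sege w1 u1 ->
    interior i j k u1 = false.
  move=> h /negP n1 /negP n2; apply/negP=> iu1.
  by case: (interior_neighbour hm iu1 h).
rewrite /retract (ni _ _ uw) // (ni _ _ wu) //.
by apply: connect1; rewrite mult_reroute_other.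
Qed.

Lemma retract_conn u w : conn T u w -> conn T' (retract u) (retract w).
Proof.
case/connectP=> p; elim: p u => [|z p IH] u /=; first by move=> _ ->; apply: connect0.
by case/andP=> /retract_adj uz hp hw; apply: connect_trans uz (IH _ hp hw).
Qed.

Lemma reroute_tour : tour_subgraph T ->
  (forall p, location_inside i j k p -> ~~ (height x < height p < height y)) ->
  tour_subgraph T'.
Proof.
move=> hT free; have [locT connT evT] := hT; split.
- move=> p lp; rewrite inE; case: ifP => [ip|_]; last exact: locT.
  by have := free p; rewrite location_interior lp ip => /(_ isT); rewrite negb_and -!leNgt.
- move=> u w /reroute_anchor[u' [u'T /negPf iu' uu']] /reroute_anchor[w' [w'T /negPf iw' ww']].
  apply: connect_trans uu' _; rewrite conn_sym in ww'; apply: connect_trans ww'.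
  by have := retract_conn (connT _ _ u'T w'T); rewrite /retract iu' iw'.
move=> u _; rewrite degree_reroute_odd ?even_degree // => u1 w1 se.
by rewrite untr //; case: ifP.
Qed.

Lemma untraveled_maximal : minimal_tour_subgraph T -> free_stretch i j k x y ->
  height y - height x <= height y0 - height x0.
Proof.
case=> hT minT [_ _ _ free]; have := minT _ (reroute_tour hT free).
have [sx sy xy _ _] := hxy.
have := sum_rerouted_length T sx sy (ltW xy).
rewrite -(sum_rerouted_length T sx0 sy0 (ltW x0y0)) -(untraveled_edges untr).
by rewrite /total_length -/(sub_edges T') /=; lra.
Qed.

End RerouteTour.

(** * The shape of a tour on the segment *)

Section UntraveledStretch.
Local Open Scope ring_scope.
Variables (R : realFieldType) (m n : nat) (W : warehouse R m n).
Variables (T : subgraph W) (i : 'I_m) (j k : 'I_n).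
Implicit Types (u w z p q x y : vertex W).

Local Notation a := (v W i j).
Local Notation b := (v W i k).
Local Notation sege := (segment_edge i j k).

Lemma segment_mult_even u w : sege u w -> ~~ odd (mult T u w) ->
  mult T u w = 0%N \/ mult T u w = 2%N.
Proof.
case/and3P=> e _ _; have := vedge_mult_le2 T e.
by case: (mult T u w) => [|[|[|?]]]; auto.
Qed.

(** The set [S] of vertices strictly between the extreme unused edges is closed
    under the edges of the tour and misses the location [q], so by connectedness
    the tour avoids [S]. *)
Lemma untraveled_stretch : merged_segment T i j k -> tour_subgraph T ->
    (exists p, is_location p /\ ~~ location_inside i j k p) ->
    (forall u w, sege u w -> ~~ odd (mult T u w)) ->
    (exists u w, sege u w /\ mult T u w = 0%N) ->
  exists x y, untraveled_exactly T i j k x y /\ free_stretch i j k x y.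
Proof.
move=> hm [locT connT _] [q [lq nq]] ev [u0 [w0 [se0 m0]]].
pose Z (e : vertex W * vertex W) := sege e.1 e.2 && (mult T e.1 e.2 == 0%N).
have Z0 : Z (u0, w0) by rewrite /Z /= se0 m0.
have [[x x1] /andP[/= sx /eqP mx] xmin] :=
  Order.TotalTheory.arg_minP (fun e : vertex W * vertex W => height e.1) Z0.
have [[y1 y] /andP[/= sy /eqP my] ymax] :=
  Order.TotalTheory.arg_maxP (fun e : vertex W * vertex W => height e.2) Z0.
exists x, y.
have [ex ax hax hx1b] := segeP _ _ _ _ _ sx.
have [ey ay1 hay1 hyb] := segeP _ _ _ _ _ sy.
have ay : aisle y = i by rewrite -(vedge_aisle ey).
have xy : height x < height y.
  have := xmin (y1, y); rewrite /Z /= sy my => /(_ isT).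
  by have := vedge_lt ey => ? ?; height_lra.
have sgx : segment_vertex i j k x by case/and3P: sx.
have sgy : segment_vertex i j k y by case/and3P: sy.
pose S z := (aisle z == i) && (height x < height z < height y).
have Sint z : S z -> interior i j k z.
  by case/and3P=> /eqP az h1 h2; apply/and3P; split; rewrite ?az //; height_lra.
have Sadj z z' : S z -> (0 < mult T z z')%N -> S z'.
  move=> Sz zz'; have [/eqP az xz zy] := and3P Sz.
  case: (interior_neighbour hm (Sint _ Sz) zz') => /segeP[e az' _ _].
    have lt := vedge_lt e; rewrite /S az' eqxx /= (lt_trans lt zy) andbT.
    have := vedge_outside e (etrans ax (esym az')) => /orP[|?]; last height_lra.
    rewrite le_eqVlt => /orP[/eqP hx|//].
    (* The only edge from [S] down to [x] is the lowest unused one. *)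
    have ez : z' = x by apply: vertex_eq; rewrite ?az' ?hx.
    by move: zz'; rewrite multC ez (_ : z = x1) ?mx // (vedge_targetI ex (w' := z)) // -ez.
  have az2 : aisle z' = i by rewrite -(vedge_aisle e).
  have lt := vedge_lt e; rewrite /S az2 eqxx /= (lt_trans xz lt) /=.
  have := vedge_outside e (etrans ay (esym az)) => /orP[?|]; first height_lra.
  rewrite le_eqVlt => /orP[/eqP hx|//].
  have ez : z' = y by apply: vertex_eq; rewrite ?az2 ?hx.
  by move: zz'; rewrite ez (_ : z = y1) ?my // (vedge_sourceI ey (u' := z)) // -ez.
have nS z : S z -> z \notin sub_vertices T.
  move=> Sz; apply/negP=> zT; case/connectP: (connT _ _ zT (locT _ lq)) => s.
  elim: s z Sz {zT} => [|z' s IH] z Sz /=.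
    by move=> _ eq; move: nq; rewrite location_interior lq eq Sint.
  by case/andP=> zz' hs; apply: IH => //; apply: Sadj zz'.
split; last first.
  split=> // p /and3P[/locT pT ap _]; apply/negP=> hp.
  by move: pT; apply/negP/nS; rewrite /S ap.
move=> u w se; have [e au hau hwb] := segeP _ _ _ _ _ se; have uw := vedge_lt e.
case: ifP => [/andP[xu wy]|nxy].
  move: xu; rewrite le_eqVlt => /orP[/eqP xu|xu].
    have eu : u = x by apply: vertex_eq; rewrite ?au ?xu.
    by rewrite eu in e *; rewrite (vedge_targetI e ex).
  apply/eqP; rewrite -leqn0 leqNgt; apply/negP=> /mult_mem[+ _]; apply/negP/nS.
  by rewrite /S au eqxx xu (lt_le_trans uw wy).
case: (segment_mult_even se (ev _ _ se)) => // muw0.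
have Ze : Z (u, w) by rewrite /Z /= se muw0.
by move: nxy; rewrite (xmin _ Ze) (ymax _ Ze).
Qed.

(** In the Top case the competing stretch goes from [a] to the lowest location,
    or to [b] if there is none: being no longer than [a]--[y], it ends at [y] in
    the first case and is absurd in the second.  Bottom is symmetric, and for Gap
    every free stretch competes. *)
Lemma merged_segment_config : minimal_tour_subgraph T -> merged_segment T i j k ->
    (exists p, is_location p /\ ~~ location_inside i j k p) ->
  exists c, has_config T i j k c.
Proof.
move=> hmin hm hout; have [hT _] := hmin.
have parity := segment_parity hm hT.
pose oddE := [exists e : vertex W * vertex W, sege e.1 e.2 && odd (mult T e.1 e.2)].
have [/existsP[[u0 w0] /andP[/= se0 odd0]]|noodd] := boolP oddE.
  exists OnePass => u w se; have := parity _ _ _ _ se se0; rewrite odd0.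
  by case/and3P: se => /(vedge_mult_le2 T); case: (mult T u w) => [|[|[|?]]].
have ev u w : sege u w -> ~~ odd (mult T u w).
  move=> se; apply: contra noodd => o; apply/existsP; exists (u, w).
  by rewrite /= se.
pose zeroE := [exists e : vertex W * vertex W, sege e.1 e.2 && (mult T e.1 e.2 == 0%N)].
have [/existsP[[u0 w0] /andP[/= se0 /eqP m0]]|nozero] := boolP zeroE; last first.
  exists TwoPass => u w se; case: (segment_mult_even se (ev _ _ se)) => // muw.
  by case/negP: nozero; apply/existsP; exists (u, w); rewrite /= se muw.
have [x [y [untr free]]] := untraveled_stretch hm hT hout ev
  (ex_intro _ u0 (ex_intro _ w0 (conj se0 m0))).
have [sx sy xy nolocxy] := free.
have [ax hax hxb] := segvP _ _ _ _ sx; have [ay hay hyb] := segvP _ _ _ _ sy.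
have ab : height a < height b by height_lra.
have sa : segment_vertex i j k a by apply/segvP; split=> //; height_lra.
have sb : segment_vertex i j k b by apply/segvP; split=> //; height_lra.
have best := fun x' y' h =>
  @untraveled_maximal _ _ _ _ T _ _ _ hm x' y' h x y sx sy xy untr hmin.
have aT : height a < height x -> a \in sub_vertices T.
  move=> lt; have [w e hwx] := vedge_above (esym ax : aisle a = aisle x) lt.
  have aw := vedge_lt e.
  have se : sege a w by apply/segeP; split=> //; height_lra.
  have : (0 < mult T a w)%N by rewrite untr // leNgt lt.
  by case/mult_mem.
have bT : height y < height b -> b \in sub_vertices T.
  move=> lt; have [u e hyu] := vedge_below (ay : aisle y = aisle b) lt.
  have ub := vedge_lt e.
  have se : sege u b by apply/segeP; split=> //; rewrite ?(vedge_aisle e) //; height_lra.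
  have : (0 < mult T u b)%N by rewrite untr // [height b <= _]leNgt lt andbF.
  by case/mult_mem.
have xP : x = a \/ height a < height x.
  by move: hax; rewrite le_eqVlt => /orP[/eqP e|]; [left; apply: vertex_eq | right].
have yP : y = b \/ height y < height b.
  by move: hyb; rewrite le_eqVlt => /orP[/eqP e|]; [left; apply: vertex_eq | right].
have inside p : location_inside i j k p ->
    [/\ aisle p = i, segment_vertex i j k p, height a < height p & height p < height b].
  case/and3P=> _ /eqP ap /andP[h1 h2]; split=> //; apply/segvP; split=> //; height_lra.
have anyloc : (exists p, location_inside i j k p) \/ (forall p, ~~ location_inside i j k p).
  have [/existsP|/existsPn] := boolP [exists p : vertex W, location_inside i j k p].
    by left.
  by right.
case: xP yP => [xa|xa] [yb|yb]; try have aV := aT xa; try have bV := bT yb.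
- exists NoEdges; split=> [p|u w se].
    apply/negP=> hp; have [_ _ h1 h2] := inside _ hp.
    by have := nolocxy _ hp; rewrite xa yb h1 h2.
  by rewrite untr // xa yb; case/segeP: se => _ _ -> ->.
- exists Top; case: anyloc => [[p0 hp0]|noloc]; last first.
    have : height b - height a <= height y - height x.
      apply: best; first by split; auto.
      by split=> // p hp; have := noloc p; rewrite hp.
    by rewrite xa; height_lra.
  have [p hp pmin] := Order.TotalTheory.arg_minP (@height R m n W) hp0.
  have [ap sp h1 h2] := inside _ hp.
  exists p; split=> //.
  suff -> : p = y by rewrite -xa.
  apply: vertex_eq; first by rewrite ap ay.
  have : height p - height a <= height y - height x.
    apply: best; first by split; auto.
    split=> // p' hp'; apply/negP=> /andP[_]; rewrite ltNge pmin //.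
  have := nolocxy _ hp; rewrite xa h1 /= -leNgt; height_lra.
- exists Bottom; case: anyloc => [[p0 hp0]|noloc]; last first.
    have : height b - height a <= height y - height x.
      apply: best; first by split; auto.
      by split=> // p hp; have := noloc p; rewrite hp.
    by rewrite yb; height_lra.
  have [p hp pmax] := Order.TotalTheory.arg_maxP (@height R m n W) hp0.
  have [ap sp h1 h2] := inside _ hp.
  exists p; split=> //.
  suff -> : p = x by rewrite -yb.
  apply: vertex_eq; first by rewrite ap ax.
  have : height b - height p <= height y - height x.
    apply: best; first by split; auto.
    split=> // p' hp'; apply/negP=> /andP[+ _]; rewrite ltNge; move/negP; apply; exact: pmax.
  have := nolocxy _ hp; rewrite yb h2 andbT -leNgt; height_lra.
(* Both endpoints are visited, so every free stretch is anchored. *)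
exists Gap, x, y; split=> // x' y' free'; apply: best => //.
by have [sx' sy' xy' _] := free'; split; auto.
Qed.

End UntraveledStretch.

Theorem lemma1 (R : realFieldType) (m n : nat) (hm : (1 <= m)%N)
    (hn : (2 <= n)%N) (W : warehouse R m n) (T : subgraph W)
    (i : 'I_m) (j k : 'I_n)
    (hT : minimal_tour_subgraph T)
    (hseg : merged_segment T i j k)
    (* The tour enters the segment from outside: not all of P lies strictly
       between the endpoints. *)
    (hout : exists p : vertex W, is_location p /\ ~~ location_inside i j k p) :
  exists c : vconfig, has_config T i j k c.
Proof. exact: merged_segment_config hT hseg hout. Qed.
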